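(* Let $P$ be a finite poset for which $J(P)$ is tCDE with edge density $\delta$. Then for every $f\in\mathcal{O}(P)$, \[\lim_{n\to\infty}\frac1n\sum_{i=0}^{n-1}\mathrm{ddeg}^{\mathrm{PL}}\big((\mathrm{row}^{\mathrm{PL}})^i(f)\big)=\delta.\]
   Context: $J(P)$ is the set of order ideals of $P$; for $I\in J(P)$, $\mathrm{ddeg}(I)$ is the number of maximal elements of $I$. For $p\in P$ the toggle $\tau_p\colon J(P)\to J(P)$ is $\tau_p(I)=I\cup\{p\}$ if $p\notin I$ and $I\cup\{p\}\in J(P)$; $I\setminus\{p\}$ if $p\in I$ and $I\setminus\{p\}\in J(P)$; $I$ otherwise; $\mathcal{T}_{p^+}(I)=1$ if $I\subsetneq\tau_p(I)$ else $0$; $\mathcal{T}_{p^-}(I)=1$ if $\tau_p(I)\subsetneq I$ else $0$; $\mathcal{T}_p=\mathcal{T}_{p^+}-\mathcal{T}_{p^-}$. A probability distribution $\mu$ on $J(P)$ is toggle-symmetric if $\mathbb{E}_\mu[\mathcal{T}_p]=0$ for all $p$. The edge density of $J(P)$ is the uniform average of $\mathrm{ddeg}$ over $J(P)$; $J(P)$ is tCDE if $\mathbb{E}_\mu[\mathrm{ddeg}]$ equals the edge density for every toggle-symmetric $\mu$. The order polytope $\mathcal{O}(P)$ is the set of $f\colon P\to\mathbb{R}$ with $0\leq f\leq1$ and $f(p)\leq f(q)$ whenever $p\leq q$. Let $\widehat P$ be $P$ with a new minimum $\widehat0$ and maximum $\widehat1$; regard $f$ as a function on $\widehat P$ with $f(\widehat0)=0$,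 $f(\widehat1)=1$. Define $\mathcal{T}^{\mathrm{PL}}_{p^-}(f)=\min\{f(q): q\in\widehat P\text{ covers }p\}-f(p)$ and $\mathrm{ddeg}^{\mathrm{PL}}=\sum_{p\in P}\mathcal{T}^{\mathrm{PL}}_{p^-}$. The piecewise-linear toggle $\tau^{\mathrm{PL}}_p$ leaves $f(q)$ unchanged for $q\neq p$ and replaces $f(p)$ by $\min\{f(x): x\in\widehat P\text{ covers }p\}+\max\{f(x): p\text{ covers }x\in\widehat P\}-f(p)$; $\mathrm{row}^{\mathrm{PL}}=\tau^{\mathrm{PL}}_{p_1}\circ\cdots\circ\tau^{\mathrm{PL}}_{p_N}$ for any linear extension $p_1,\ldots,p_N$ of $P$. *)

(* Defs.v *)
From HB Require Import structures.
From mathcomp Require Import all_boot all_order all_algebra.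
From mathcomp Require Import all_classical all_reals all_analysis.

Set Implicit Arguments.
Unset Strict Implicit.
Unset Printing Implicit Defensive.

Import Order.TTheory GRing.Theory Num.Theory.
Import numFieldNormedType.Exports.

Local Open Scope ring_scope.

Section OrderIdeals.
Context {d : Order.disp_t} {P : finPOrderType d}.
Implicit Types (p q : P) (I : {set P}).

Definition is_ideal I : bool :=
  [forall q in I, forall p, (p <= q)%O ==> (p \in I)].

Definition ideals : {set {set P}} := [set I | is_ideal I].

Definition ddeg I : nat :=
  #|[set p in I | [forall q in I, ~~ (p < q)%O]]|.

Definition toggle p I : {set P} :=
  if (p \notin I) && (p |: I \in ideals) then p |: I
  else if (p \in I) && (I :\ p \in ideals) then I :\ p
  else I.

Lemma toggle_ideals p I : I \in ideals -> toggle p I \in ideals.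
Proof.
by move=> ideal_I; rewrite /toggle; do 2?[case: ifP => [/andP[]|_] //].
Qed.

End OrderIdeals.

Arguments ideals {d} P.

Section ToggleSymmetry.
Context {d : Order.disp_t} (P : finPOrderType d) (R : realType).
Implicit Types (p : P) (I : {set P}) (mu F : {set P} -> R).

Definition toggle_plus p I : R := (I \proper toggle p I)%:R.
Definition toggle_minus p I : R := (toggle p I \proper I)%:R.
Definition toggle_stat p I : R := toggle_plus p I - toggle_minus p I.

(* A distribution on J(P) is a function on all subsets of P of which only the
   values at order ideals are ever used. *)
Definition is_distribution mu : Prop :=
  (forall I, I \in ideals P -> 0 <= mu I) /\ \sum_(I in ideals P) mu I = 1.

Definition expectation mu F : R := \sum_(I in ideals P) mu I * F I.

Definition toggle_symmetric mu : Prop :=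
  forall p, expectation mu (toggle_stat p) = 0.

Definition edge_density : R :=
  (\sum_(I in ideals P) (ddeg I)%:R) / #|ideals P|%:R.

Definition tCDE : Prop :=
  forall mu, is_distribution mu -> toggle_symmetric mu ->
    expectation mu (fun I => (ddeg I)%:R) = edge_density.

End ToggleSymmetry.

(* None is the new minimum, Some None the new maximum, and Some (Some p) the
   element p of P. *)
Definition hat (P : Type) : Type := option (option P).

HB.instance Definition _ (P : finType) := Finite.on (hat P).

Definition hbot {P : Type} : hat P := None.
Definition htop {P : Type} : hat P := Some None.
Definition hin {P : Type} (p : P) : hat P := Some (Some p).

Section HatOrder.
Context {d : Order.disp_t} {P : finPOrderType d}.

Definition hat_le (x y : hat P) : bool :=
  match x, y with
  | None, _ => true
  | _, Some None => true
  | Some (Some p), Some (Some q) => (p <= q)%O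
  | _, _ => false
  end.

Fact hat_le_refl : reflexive hat_le.
Proof. by case=> [[p|]|] //=. Qed.

Fact hat_le_anti : antisymmetric hat_le.
Proof. by case=> [[p|]|] [[q|]|] //= /le_anti->. Qed.

Fact hat_le_trans : transitive hat_le.
Proof. by case=> [[p|]|] [[q|]|] [[r|]|] //=; exact: le_trans. Qed.

HB.instance Definition _ :=
  Order.Le_isPOrder.Build d (hat P) hat_le_refl hat_le_anti hat_le_trans.

End HatOrder.

(* covers y x: y covers x. *)
Definition covers {d : Order.disp_t} {T : finPOrderType d} (y x : T) : bool :=
  (x < y)%O && ~~ [exists z, (x < z < y)%O].

(* Minimum and maximum of a nonempty sequence; 0 for the empty sequence. *)
Definition seq_min {R : realType} (s : seq R) : R :=
  \big[Num.min/head 0 s]_(x <- s) x.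
Definition seq_max {R : realType} (s : seq R) : R :=
  \big[Num.max/head 0 s]_(x <- s) x.

Section PiecewiseLinear.
Context {d : Order.disp_t} {P : finPOrderType d} {R : realType}.
Implicit Types (p q : P) (f : P -> R) (s : seq P).

Definition in_order_polytope f : Prop :=
  (forall p, 0 <= f p <= 1) /\ (forall p q, (p <= q)%O -> f p <= f q).

Definition hat_fun f (x : hat P) : R :=
  match x with
  | None => 0
  | Some None => 1
  | Some (Some p) => f p
  end.

Definition min_above f p : R :=
  seq_min [seq hat_fun f x | x <- enum [pred x : hat P | covers x (hin p)]].
Definition max_below f p : R :=
  seq_max [seq hat_fun f x | x <- enum [pred x : hat P | covers (hin p) x]].

Definition pl_toggle_minus p f : R := min_above f p - f p.

Definition pl_ddeg f : R := \sum_p pl_toggle_minus p f.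

Definition pl_toggle p f : P -> R :=
  fun q => if q == p then min_above f p + max_below f p - f p else f q.

Definition linear_extension s : Prop :=
  [/\ uniq s, forall p, p \in s
    & forall p q, (p < q)%O -> (index p s < index q s)%N].

(* For s = [:: p_1; ...; p_N] the toggle at p_N is applied first. *)
Definition pl_row s f : P -> R := foldr pl_toggle f s.

End PiecewiseLinear.

Section Sanity.
Context {d : Order.disp_t} {P : finPOrderType d} {R : realType}.

Lemma seq_minP (s : seq R) : s != [::] ->
  seq_min s \in s /\ forall x, x \in s -> seq_min s <= x.
Proof.
case: s => [|a s] // _; rewrite /seq_min /=; split; last first.
  move: (a :: s) => t; elim: t => // b t IHt x; rewrite big_cons inE ge_min.
  by case/predU1P => [->|/IHt ->]; rewrite ?lexx ?orbT.
rewrite big_cons; elim: s => [|b s IHs].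
  by rewrite big_nil minxx mem_head.
rewrite big_cons minCA; have [_|_] := leP b; first by rewrite !inE eqxx orbT.
by move: IHs; rewrite !inE => /orP[->|->]; rewrite ?orbT.
Qed.

Lemma seq_maxP (s : seq R) : s != [::] ->
  seq_max s \in s /\ forall x, x \in s -> x <= seq_max s.
Proof.
case: s => [|a s] // _; rewrite /seq_max /=; split; last first.
  by move=> x xs; exact: (le_bigmax_seq _ _ xpredT id xs).
rewrite big_cons; elim: s => [|b s IHs].
  by rewrite big_nil maxxx mem_head.
rewrite big_cons maxCA; have [_|_] := leP b; last by rewrite !inE eqxx orbT.
by move: IHs; rewrite !inE => /orP[->|->]; rewrite ?orbT.
Qed.

Lemma linear_extension_exists : exists s : seq P, linear_extension s.
Proof.
pose h (p : P) := #|[set q : P | (q <= p)%O]|.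
pose r := [rel p q : P | (h p <= h q)%N].
have rt : total r by move=> p q; exact: leq_total.
have rtr : transitive r by move=> p q t; exact: leq_trans.
exists (sort r (enum P)); split=> [|p|p q pq].
- by rewrite sort_uniq enum_uniq.
- by rewrite mem_sort mem_enum.
have hpq : (h p < h q)%N.
  apply/proper_card/properP; split.
    by apply/fintype.subsetP => x; rewrite !inE => /le_trans; apply; exact: ltW.
  by exists q; rewrite !inE ?lexx // lt_geF.
rewrite ltnNge; apply/negP => ipq.
have rqp : r q p.
  apply: (sorted_leq_index rtr _ (sort_sorted rt _)) ipq;
    rewrite ?mem_sort ?mem_enum //.
  by move=> x; exact: leqnn.
by move: rqp; rewrite /= leqNgt hpq.
Qed.

Lemma covers_above (p : P) : exists x : hat P, covers x (hin p).
Proof.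
pose h (x : hat P) := #|[set y : hat P | (y <= x)%O]|.
case: (@arg_minnP _ htop [pred x : hat P | (hin p < x)%O] h) => [//|x px xmin].
exists x; rewrite /covers [X in X && _]px; apply/existsPn => y; apply/negP => /andP[py yx].
have := xmin y py; apply/negP; rewrite -ltnNge.
apply/proper_card/properP; split.
  by apply/fintype.subsetP => z; rewrite !inE => /le_trans; apply; exact: ltW.
by exists x; rewrite !inE ?lexx // lt_geF.
Qed.

Lemma covers_below (p : P) : exists x : hat P, covers (hin p) x.
Proof.
pose h (x : hat P) := #|[set y : hat P | (y <= x)%O]|.
case: (@arg_maxnP _ hbot [pred x : hat P | (x < hin p)%O] h) => [//|x px xmax].
exists x; rewrite /covers [X in X && _]px; apply/existsPn => y; apply/negP => /andP[xy yp].
have := xmax y yp; apply/negP; rewrite -ltnNge.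
apply/proper_card/properP; split.
  by apply/fintype.subsetP => z; rewrite !inE => /le_trans; apply; exact: ltW.
by exists y; rewrite !inE ?lexx // lt_geF.
Qed.

End Sanity.

(* Main.v *)
Require Import Defs.
From HB Require Import structures.
From mathcomp Require Import all_boot all_order all_algebra.
From mathcomp Require Import all_classical all_reals all_analysis.
From mathcomp Require Import lra.
Import Order.TTheory GRing.Theory Num.Theory.
Import numFieldNormedType.Exports.
Local Open Scope classical_set_scope.
Local Open Scope ring_scope.

(**
The uniform distribution is toggle-symmetric with full support, so tCDE means
that ddeg is, as a function on J(P), delta plus a linear combination of the
toggleability statistics T_p. For f in the order polytope, the sublevel sets
{p | f p <= t}, 0 <= t < 1, are order ideals, and averaging this identity over t
yields its piecewise-linear analogue. Finally T_p^PL = T_(p+)^PL - T_(p-)^PL and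
T_(p-)^PL (row f) = T_(p+)^PL f, so the sum of T_p^PL along an orbit telescopes
and stays bounded; hence the averages of ddeg^PL tend to delta.
*)

(** * Order ideals and toggle statistics *)

Section Ideals.
Context {d : Order.disp_t} {P : finPOrderType d}.
Implicit Types (p q : P) (I : {set P}).

Lemma idealP I :
  reflect (forall p q, (p <= q)%O -> q \in I -> p \in I) (I \in ideals P).
Proof.
rewrite inE; apply: (iffP forallP) => [idI p q pq qI|idI q].
  by have /implyP/(_ qI)/forallP/(_ p)/implyP/(_ pq) := idI q.
by apply/implyP => qI; apply/forallP => p; apply/implyP => pq; exact: idI qI.
Qed.

Lemma idealU1 p I : I \in ideals P -> p \notin I ->
  (p |: I \in ideals P) = [forall q, (q < p)%O ==> (q \in I)].
Proof.
move=> /idealP idI pI; apply/idealP/forallP => [idU q|lowI x y xy].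
  apply/implyP => qp; have := idU q p (ltW qp) (finset.setU11 _ _).
  by rewrite !inE (lt_eqF qp).
rewrite !inE => /predU1P[yp|yI]; last by rewrite (idI x y) ?orbT.
have [//|xp] := eqVneq x p; have /implyP/= := lowI x; apply.
by rewrite lt_neqAle xp -yp.
Qed.

Lemma idealD1 p I : I \in ideals P -> p \in I ->
  (I :\ p \in ideals P) = [forall q in I, ~~ (p < q)%O].
Proof.
move=> /idealP idI pI; apply/idealP/forallP => [idD q|maxI x y xy].
  apply/implyP => qI; apply/negP => pq.
  have := idD p q (ltW pq); rewrite !inE qI eqxx /= andbT => H.
  by have := H (negbT (gt_eqF pq)).
rewrite !inE => /andP[yp yI]; rewrite (idI x y xy yI) andbT.
apply/eqP => xp; have /implyP/(_ yI)/negP := maxI y; apply.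
by rewrite lt_neqAle -xp xy eq_sym xp yp.
Qed.

Lemma toggleK p I : I \in ideals P -> toggle p (toggle p I) = I.
Proof.
move=> idI; rewrite {2}/toggle; case: ifP => [/andP[pI UI]|nU].
  rewrite /toggle finset.setU11 /= setU1K // idI //.
case: ifP => [/andP[pI DI]|nD]; last by rewrite /toggle nU nD.
by rewrite /toggle finset.setD11 /= finset.setD1K // idI.
Qed.

Lemma proper_toggle p I : I \in ideals P ->
  (I \proper toggle p I) =
    (p \notin I) && [forall q, (q < p)%O ==> (q \in I)].
Proof.
move=> idI; rewrite /toggle; have [pI|pI] /= := boolP (p \in I).
  case: ifP => _; last by rewrite fintype.properxx.
  apply/negP => /fintype.proper_sub/fintype.subsetP/(_ p pI).
  by rewrite finset.setD11.
rewrite -idealU1 //; case: ifP => _; last by rewrite fintype.properxx.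
rewrite fintype.properE finset.subsetUr finset.subUset finset.sub1set.
by rewrite (negbTE pI).
Qed.

Lemma toggle_proper p I : I \in ideals P ->
  (toggle p I \proper I) = (p \in I) && [forall q in I, ~~ (p < q)%O].
Proof.
move=> idI; rewrite /toggle; have [pI|pI] /= := boolP (p \in I).
  rewrite -idealD1 //; case: ifP => _; rewrite ?fintype.properxx //.
  by rewrite finset.properD1.
case: ifP => _; last by rewrite fintype.properxx.
apply/negP => /fintype.proper_sub/fintype.subsetP/(_ p (finset.setU11 _ _)).
by rewrite (negbTE pI).
Qed.

Lemma ddeg_sum (R : realType) I : I \in ideals P ->
  (ddeg I)%:R = \sum_p toggle_minus R p I.
Proof.
move=> idI; rewrite /ddeg -sum1_card natr_sum big_mkcond /=.
apply: eq_bigr => p _; rewrite /toggle_minus toggle_proper // inE.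
by case: ifP.
Qed.

(** Toggling at [p] is an involution of the ideals that exchanges additions and removals, so the two
    sums agree: the uniform distribution is toggle-symmetric. *)
Lemma sum_toggle_stat (R : realType) p :
  \sum_(I in ideals P) toggle_stat R p I = 0.
Proof.
rewrite /toggle_stat big_split /= sumrN; apply/eqP; rewrite subr_eq0; apply/eqP.
rewrite [RHS](reindex_onto (toggle p) (toggle p)) /=; last first.
  by move=> I; exact: toggleK.
apply: eq_big => [I|I idI].
  apply/idP/andP => [idI|[idI /eqP <-]]; last exact: toggle_ideals.
  by split; [exact: toggle_ideals | rewrite toggleK].
by rewrite /toggle_minus toggleK.
Qed.

Lemma ideals_gt0 (R : realType) : 0 < #|ideals P|%:R :> R.
Proof.
rewrite ltr0n; apply/card_gt0P; exists finset.set0; apply/idealP => p q _.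
by rewrite inE.
Qed.

End Ideals.

(** * From tCDE to a linear identity on ideals *)

Section Homomesy.
Context {d : Order.disp_t} {P : finPOrderType d} {R : realType}.

(* The uniform distribution has full support, so it stays a distribution when
   perturbed by a small multiple of nu. *)
Lemma tCDE_orthogonal (nu : {set P} -> R) : tCDE P R ->
  \sum_(I in ideals P) nu I = 0 ->
  (forall p, Defs.expectation nu (toggle_stat R p) = 0) ->
  Defs.expectation nu (fun I => (ddeg I)%:R) = 0.
Proof.
move=> tcde nu0 nuT.
(* [M] exceeds every [|nu I|] and is positive even for [nu = 0], so [1 + M^-1 * nu I] is positive on
   ideals. *)
pose M := 1 + \sum_(I in ideals P) `|nu I|.
have M0 : 0 < M by rewrite ltr_pwDl // sumr_ge0.
pose N : R := #|ideals P|%:R.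
have N0 : 0 < N := ideals_gt0 R.
pose mu I := N^-1 * (1 + M^-1 * nu I).
have muE F : Defs.expectation mu F =
    N^-1 * (\sum_(I in ideals P) F I + M^-1 * Defs.expectation nu F).
  rewrite /Defs.expectation mulr_sumr -big_split /= mulr_sumr.
  by apply: eq_bigr => I _; rewrite /mu -mulrA mulrDl mul1r mulrA.
have mud : is_distribution mu.
  split=> [I idI|].
    rewrite mulr_ge0 ?invr_ge0 1?ltW // -[1](mulVf (lt0r_neq0 M0)) -mulrDr.
    rewrite pmulr_rgt0 ?invr_gt0 // /M (bigD1 I) //=.
    have := ler_norm (- nu I); rewrite normrN.
    have : 0 <= \sum_(i in ideals P | i != I) `|nu i| by rewrite sumr_ge0.
    by move: (\sum_(i in _ | _) _) => x; lra.
  have := muE (fun=> 1); rewrite /Defs.expectation.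
  under eq_bigr do rewrite mulr1.
  under [X in _ * (_ + _ * X)]eq_bigr do rewrite mulr1.
  by rewrite nu0 mulr0 addr0 sumr_const mulVf ?lt0r_neq0 // => ->.
have mus : toggle_symmetric mu.
  by move=> p; rewrite muE nuT sum_toggle_stat mulr0 addr0 mulr0.
have := tcde mu mud mus; rewrite muE /edge_density mulrDr.
(* The uniform part of the expectation is the edge density itself; cancelling it leaves a nonzero
   multiple of the [nu] part. *)
rewrite [X in _ = X]mulrC -[RHS]addr0 => /addrI/eqP.
by rewrite !mulf_eq0 !invr_eq0 (gt_eqF N0) (gt_eqF M0) => /eqP.
Qed.

(** Linear duality: by [tCDE_orthogonal], whatever is orthogonal to the constants and to all toggle
    statistics is orthogonal to [ddeg], so [ddeg] lies in their span. *)
Lemma tCDE_span : tCDE P R -> exists c : P -> R, forall I, I \in ideals P ->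
  (ddeg I)%:R = edge_density P R + \sum_p c p * toggle_stat R p I.
Proof.
move=> tcde.
(* Extension by zero lets the matrix columns range over all subsets. Row [None] is the constant 1,
   row [Some p] the statistic at [p]. *)
pose on_ideals F (I : {set P}) : R := if I \in ideals P then F I else 0.
pose g (o : option P) :=
  on_ideals (if o is Some p then toggle_stat R p else fun=> 1).
pose A := \matrix_(i < #|{: option P}|, j < #|{: {set P}}|)
  g (enum_val i) (enum_val j).
pose u := \row_(j < #|{: {set P}}|)
  on_ideals (fun I => (ddeg I)%:R) (enum_val j).
have sum_rank (T : finType) (F : 'I_#|T| -> R) :
    \sum_j F j = \sum_x F (enum_rank x).
  by rewrite (reindex _ (onW_bij _ (@enum_rank_bij T))).
have pairing F (nu : {set P} -> R) :
    \sum_I on_ideals F I * nu I = Defs.expectation nu F.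
  rewrite /Defs.expectation [RHS]big_mkcond /=; apply: eq_bigr => I _.
  by rewrite /on_ideals; case: ifP => _; rewrite ?mul0r // mulrC.
have /submxP[D uDA] : (u <= A)%MS.
  (* Membership in the row space means vanishing against [cokermx A]; each column of it is a weight
     [nu] orthogonal to all rows of [A]. *)
  rewrite submxE; apply/eqP/rowP => k; rewrite !mxE.
  pose nu I := cokermx A (enum_rank I) k.
  have nuA o : \sum_I g o I * nu I = 0.
    have /matrixP/(_ (enum_rank o) k) := mulmx_coker A.
    rewrite !mxE sum_rank; apply: etrans.
    by apply: eq_bigr => I _; rewrite mxE !enum_rankK.
  rewrite sum_rank; under eq_bigr do rewrite mxE enum_rankK.
  rewrite (pairing _ nu) tCDE_orthogonal // => [|p].
    have := nuA None; rewrite /g pairing /Defs.expectation.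
    by under eq_bigr do rewrite mulr1.
  by rewrite -pairing; exact: nuA (Some p).
pose c o := D ord0 (enum_rank o).
have cE I : I \in ideals P ->
    (ddeg I)%:R = c None + \sum_p c (Some p) * toggle_stat R p I.
  move=> idI; have /rowP/(_ (enum_rank I)) := uDA.
  rewrite !mxE enum_rankK /on_ideals idI => ->.
  rewrite sum_rank (bigD1 None) //= mxE !enum_rankK /g /on_ideals idI mulr1.
  congr (_ + _); rewrite (reindex_omap Some id) /=; last by case.
  apply: eq_big => p; rewrite ?eqxx // => _.
  by rewrite mxE !enum_rankK /g /on_ideals idI.
exists (c \o some) => I idI; rewrite cE //; congr (_ + _).
(* Summing [cE] over all ideals kills the toggle statistics and identifies [c None] with the edge
   density. *)
have N0 := lt0r_neq0 (@ideals_gt0 _ P R).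
apply: (mulIf N0); rewrite /edge_density divfK // (eq_bigr _ cE) big_split /=.
rewrite sumr_const mulr_natr exchange_big /= [X in _ + X]big1 ?addr0 // => p _.
by rewrite -mulr_sumr sum_toggle_stat mulr0.
Qed.

End Homomesy.

(** * Covers inside intervals of a finite poset *)

Lemma exists_cover_le {d : Order.disp_t} {T : finPOrderType d} (x y : T) :
  (x < y)%O -> exists2 z, covers z x & (z <= y)%O.
Proof.
(* The size of the principal down-set is strictly monotone, so a minimizer of [h] is a minimal
   element of the interval above [x]. *)
move=> xy; pose h (z : T) := #|[set w : T | (w <= z)%O]%SET|.
case: (@arg_minnP _ y [pred z : T | (x < z <= y)%O] h) => [|z /andP[xz zy] zmin].
  by rewrite /= xy lexx.
exists z => //; rewrite /covers xz; apply/existsPn => w.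
apply/negP => /andP[xw wz].
have := zmin w; rewrite /= xw (le_trans (ltW wz) zy) => /(_ isT); apply/negP.
rewrite -ltnNge; apply/proper_card/fintype.properP; split.
  by apply/fintype.subsetP => t; rewrite !inE => /le_trans; apply; exact: ltW.
by exists z; rewrite !inE ?lexx // lt_geF.
Qed.

Lemma exists_cocover_ge {d : Order.disp_t} {T : finPOrderType d} (x y : T) :
  (x < y)%O -> exists2 z, covers y z & (x <= z)%O.
Proof.
move=> xy; pose h (z : T) := #|[set w : T | (w <= z)%O]%SET|.
case: (@arg_maxnP _ x [pred z : T | (x <= z < y)%O] h) => [|z /andP[xz zy] zmax].
  by rewrite /= xy lexx.
exists z => //; rewrite /covers zy; apply/existsPn => w.
apply/negP => /andP[zw wy].
have := zmax w; rewrite /= wy (le_trans xz (ltW zw)) => /(_ isT); apply/negP.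
rewrite -ltnNge; apply/proper_card/fintype.properP; split.
  by apply/fintype.subsetP => t; rewrite !inE => /le_trans; apply; exact: ltW.
by exists w; rewrite !inE ?lexx // lt_geF.
Qed.

(** * Piecewise-linear toggles and sublevel ideals *)

Section OrderPolytope.
Context {d : Order.disp_t} {P : finPOrderType d} {R : realType}.
Implicit Types (p q : P) (f g : P -> R) (x y : hat P) (s : seq P).

Lemma ltEhat p q : (hin p < hin q)%O = (p < q)%O.
Proof. by rewrite !lt_neqAle. Qed.

Lemma min_above_attained f p :
  exists2 x, covers x (hin p) & min_above f p = hat_fun f x.
Proof.
have [x0 x0p] := covers_above p.
have [|/mapP[x xp fx] _] := @seq_minP R
    [seq hat_fun f x | x <- enum [pred x : hat P | covers x (hin p)]].
  by rewrite -size_eq0 size_map -cardE -lt0n; apply/card_gt0P; exists x0.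
exists x => [|]; last exact: fx.
by move: xp; rewrite mem_enum.
Qed.

Lemma max_below_attained f p :
  exists2 x, covers (hin p) x & max_below f p = hat_fun f x.
Proof.
have [x0 x0p] := covers_below p.
have [|/mapP[x xp fx] _] := @seq_maxP R
    [seq hat_fun f x | x <- enum [pred x : hat P | covers (hin p) x]].
  by rewrite -size_eq0 size_map -cardE -lt0n; apply/card_gt0P; exists x0.
exists x => [|]; last exact: fx.
by move: xp; rewrite mem_enum.
Qed.

Lemma min_above_covers f p x : covers x (hin p) -> min_above f p <= hat_fun f x.
Proof.
move=> xp.
set l := [seq hat_fun f x | x <- enum [pred x : hat P | covers x (hin p)]].
have xl : hat_fun f x \in l by rewrite map_f // mem_enum.
have [|_ lmin] := @seq_minP R l; [by case: l xl | exact: lmin].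
Qed.

Lemma max_below_covers f p x : covers (hin p) x -> hat_fun f x <= max_below f p.
Proof.
move=> xp.
set l := [seq hat_fun f x | x <- enum [pred x : hat P | covers (hin p) x]].
have xl : hat_fun f x \in l by rewrite map_f // mem_enum.
have [|_ lmax] := @seq_maxP R l; [by case: l xl | exact: lmax].
Qed.

Lemma eq_min_above f g p :
  (forall q, (p < q)%O -> f q = g q) -> min_above f p = min_above g p.
Proof.
move=> fg; congr seq_min; apply/eq_in_map => -[[q|]|] //.
by rewrite mem_enum => /andP[pq _]; rewrite /= fg // -ltEhat.
Qed.

Lemma eq_max_below f g p :
  (forall q, (q < p)%O -> f q = g q) -> max_below f p = max_below g p.
Proof.
move=> fg; congr seq_max; apply/eq_in_map => -[[q|]|] //.
by rewrite mem_enum => /andP[pq _]; rewrite /= fg // -ltEhat.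
Qed.

Section InPolytope.
Variable f : P -> R.
Hypothesis fO : in_order_polytope f.

Lemma hat_fun_bounds x : 0 <= hat_fun f x <= 1.
Proof. by case: x => [[p|]|] /=; [exact: fO.1 | rewrite ler01 lexx..]. Qed.

Lemma hat_fun_homo x y : (x <= y)%O -> hat_fun f x <= hat_fun f y.
Proof.
case: x y => [[p|]|] [[q|]|] //= pq; rewrite ?lexx ?ler01 //.
- exact: fO.2.
- by case/andP: (fO.1 p).
- by case/andP: (fO.1 q).
Qed.

Lemma min_above_le x p : (hin p < x)%O -> min_above f p <= hat_fun f x.
Proof.
move=> /exists_cover_le[z zp zx].
exact: le_trans (min_above_covers _ _ _ zp) (hat_fun_homo _ _ zx).
Qed.

Lemma max_below_ge x p : (x < hin p)%O -> hat_fun f x <= max_below f p.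
Proof.
move=> /exists_cocover_ge[z zp xz].
exact: le_trans (hat_fun_homo _ _ xz) (max_below_covers _ _ _ zp).
Qed.

(** The conjunct [v < 1] comes from [htop]; monotonicity of [f] lets all elements above [p] replace
    its covers. *)
Lemma lt_min_above v p :
  (v < min_above f p) = (v < 1) && [forall q, (p < q)%O ==> (v < f q)].
Proof.
apply/idP/andP => [vm|[v1 /forallP vf]].
  split; first exact: lt_le_trans vm (min_above_le htop p isT).
  apply/forallP => q; apply/implyP; rewrite -ltEhat => pq.
  exact: lt_le_trans vm (min_above_le (hin q) p pq).
have [[[q|]|] /andP[px _] ->] //= := min_above_attained f p.
by have /implyP := vf q; apply; rewrite -ltEhat.
Qed.

Lemma max_below_le v p :
  (max_below f p <= v) = (0 <= v) && [forall q, (q < p)%O ==> (f q <= v)].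
Proof.
apply/idP/andP => [mv|[v0 /forallP vf]].
  split; first exact: le_trans (max_below_ge hbot p isT) mv.
  apply/forallP => q; apply/implyP; rewrite -ltEhat => qp.
  exact: le_trans (max_below_ge (hin q) p qp) mv.
have [[[q|]|] /andP[px _] ->] //= := max_below_attained f p.
by have /implyP := vf q; apply; rewrite -ltEhat.
Qed.

Lemma toggle_bounds p :
  [/\ 0 <= max_below f p, max_below f p <= f p, f p <= min_above f p
    & min_above f p <= 1].
Proof.
split; [exact: (max_below_ge hbot) | | | exact: (min_above_le htop)].
  have [x /andP[xp _] ->] := max_below_attained f p.
  exact: (hat_fun_homo x (hin p) (ltW xp)).
have [x /andP[px _] ->] := min_above_attained f p.
exact: (hat_fun_homo (hin p) x (ltW px)).
Qed.

(** The new value reflects [f p] within the interval from [max_below f p] to [min_above f p], so it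
    stays between the values below and above [p]. *)
Lemma pl_toggle_polytope p : in_order_polytope (pl_toggle p f).
Proof.
have [b0 b1 b2 b3] := toggle_bounds p.
split=> [q|q r]; rewrite /pl_toggle; first by case: eqP => _; [lra|exact: fO.1].
rewrite le_eqVlt => /predU1P[->//|qr].
case: eqP => [qp|_]; case: eqP => [rp|_].
- by rewrite qp rp ltxx in qr.
- rewrite qp -ltEhat in qr; have /= := min_above_le (hin r) p qr; lra.
- rewrite rp -ltEhat in qr; have /= := max_below_ge (hin q) p qr; lra.
- exact/fO.2/ltW.
Qed.

Definition sublevel (v : R) : {set P} := [set p | f p <= v]%SET.

Lemma sublevel_ideal v : sublevel v \in ideals P.
Proof. by apply/idealP => p q pq; rewrite !inE; exact/le_trans/fO.2. Qed.

(** [p] is maximal in the sublevel ideal exactly when [f p <= v < min_above f p], an interval of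
    length [pl_toggle_minus p f]. At [v = 1] the bound from [htop] would fail. *)
Lemma toggle_minus_sublevel v p : v < 1 ->
  toggle_minus R p (sublevel v) =
    (v < min_above f p)%R%:R - (v < f p)%R%:R.
Proof.
move=> v1; rewrite /toggle_minus toggle_proper ?sublevel_ideal // inE.
have [_ _ fm _] := toggle_bounds p.
have [fv|vf] /= := leP (f p) v; last by rewrite (lt_le_trans vf fm) subrr.
rewrite subr0 lt_min_above v1; congr ((nat_of_bool _)%:R).
apply: eq_forallb => q; rewrite inE -implybNN negbK.
by case: (p < q)%O; rewrite ?implybT //= -ltNge.
Qed.

(** [p] can be added exactly when [max_below f p <= v < f p]; the bound on [v] handles [hbot]. *)
Lemma toggle_plus_sublevel v p : 0 <= v ->
  toggle_plus R p (sublevel v) =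
    (v < f p)%R%:R - (v < max_below f p)%R%:R.
Proof.
move=> v0; rewrite /toggle_plus proper_toggle ?sublevel_ideal // inE.
have [_ mf _ _] := toggle_bounds p; rewrite [(v < max_below _ _)%R]ltNge.
have [fv|vf] /= := leP (f p) v; first by rewrite (le_trans mf fv) subrr.
rewrite max_below_le v0 /=.
rewrite (eq_forallb (P2 := fun q => (q < p)%O ==> (f q <= v))); last first.
  by move=> q; rewrite inE.
by case: [forall _, _]; rewrite /= ?subrr ?subr0.
Qed.

End InPolytope.

Lemma pl_row_polytope s f :
  in_order_polytope f -> in_order_polytope (pl_row s f).
Proof. by move=> fO; elim: s => //= p s IHs; exact: pl_toggle_polytope. Qed.

Lemma pl_row_notin s f q : q \notin s -> pl_row s f q = f q.
Proof.
elim: s => //= p s IHs; rewrite inE negb_or /pl_toggle.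
by case/andP=> /negbTE -> /IHs.
Qed.

(* When p is toggled, the elements above it already carry their final values
   and those below it still carry their initial ones. *)
Lemma pl_toggle_minus_row s f p : linear_extension s ->
  pl_toggle_minus p (pl_row s f) = f p - max_below f p.
Proof.
case=> s_uniq s_all s_lt; have ps := s_all p.
case/splitPr: ps s_uniq s_lt s_all => s1 s2.
rewrite cat_uniq /= => /and3P[_ /norP[ps1 /hasPn s12] /andP[ps2 _]] s_lt s_all.
have idxp : index p (s1 ++ p :: s2) = size s1.
  by rewrite index_cat (negbTE ps1) /= eqxx addn0.
have below q : (q < p)%O -> q \notin s2.
  move=> qp; apply/negP => /s12/= qs1; have := s_lt q p qp.
  by rewrite idxp index_cat (negbTE qs1) ltnNge leq_addr.
have above q : (p < q)%O -> q \notin s1.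
  move=> pq; apply/negP => qs1; have := s_lt p q pq.
  by rewrite idxp index_cat qs1 ltnNge ltnW // index_mem.
have rowE : pl_row (s1 ++ p :: s2) f = pl_row s1 (pl_toggle p (pl_row s2 f)).
  by rewrite /pl_row foldr_cat.
rewrite /pl_toggle_minus rowE (pl_row_notin s1) // {2}/pl_toggle eqxx.
rewrite (pl_row_notin s2) // (eq_max_below (pl_row s2 f) f); last first.
  by move=> q /below; exact: pl_row_notin.
rewrite (eq_min_above _ (pl_row s2 f)); first by lra.
by move=> q pq; rewrite pl_row_notin ?above // /pl_toggle gt_eqF.
Qed.

End OrderPolytope.

(** * A finite substitute for integrating over thresholds *)

Section Quadrature.
Context {R : realType}.

(** Nodes are left endpoints of consecutive gaps and weights are gap lengths; the gaps to the left
    of [b] telescope. *)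
Lemma path_quadrature (a : R) (l : seq R) : path <%R a l ->
  exists2 ws : seq (R * R),
    forall x, x \in ws -> a <= x.2 /\ exists2 u, u \in l & x.2 < u
  & forall b, b \in a :: l ->
      \sum_(x <- ws) x.1 * (x.2 < b)%R%:R = b - a.
Proof.
elim: l a => [|c l IHl] a /=.
  move=> _; exists [::] => // b.
  by rewrite inE big_nil => /eqP ->; rewrite subrr.
case/andP=> ac cl; have [ws wsP wsE] := IHl c cl.
exists ((c - a, a) :: ws) => [x|b].
  rewrite inE => /predU1P[->|/wsP[cx [u ul xu]]] /=.
    by split=> //; exists c => //; rewrite mem_head.
  split; first exact: le_trans (ltW ac) cx.
  by exists u => //; rewrite inE ul orbT.
rewrite inE big_cons /= => /predU1P[->|bl].
  rewrite ltxx mulr0 add0r subrr big_seq big1 // => x /wsP[cx _].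
  by rewrite ltNge (le_trans (ltW ac) cx) mulr0.
have -> : (a < b)%R.
  move: bl; rewrite inE => /predU1P[->//|bl].
  exact: lt_trans ac (allP (lt_path_min cl) b bl).
by rewrite wsE // mulr1; lra.
Qed.

(** A discrete form of the layer-cake formula: [b] is the integral over [v] in [0, 1) of the
    indicator of [v < b], exact for the finitely many values in [B]. *)
Lemma threshold_quadrature (B : seq R) : (forall b, b \in B -> 0 <= b <= 1) ->
  exists2 ws : seq (R * R), forall x, x \in ws -> 0 <= x.2 < 1
  & forall b, b \in B -> \sum_(x <- ws) x.1 * (x.2 < b)%R%:R = b.
Proof.
(* Zeros and repetitions are dropped so that [0 :: l] is strictly increasing; the value 0 is covered
   by the starting point. *)
move=> B01; pose l := sort <=%R (undup [seq b <- B | 0 < b]).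
have lE b : (b \in l) = (0 < b) && (b \in B).
  by rewrite mem_sort mem_undup mem_filter.
have [|ws wsP wsE] := @path_quadrature 0 l.
  rewrite lt_path_sortedE lt_sorted_uniq_le sort_uniq undup_uniq sort_le_sorted.
  by rewrite !andbT; apply/allP => b; rewrite lE => /andP[].
exists ws => [x /wsP[-> [u]]|b bB].
  by rewrite lE => /andP[_ /B01/andP[_ u1]] xu; exact: lt_le_trans xu u1.
rewrite wsE ?subr0 // inE lE bB andbT.
by have /andP[b0 _] := B01 b bB; rewrite eq_sym -le_eqVlt.
Qed.

End Quadrature.

(** * Transfer to the order polytope *)

Section PLTransfer.
Context {d : Order.disp_t} {P : finPOrderType d} {R : realType}.

(* Linear relations among the combinatorial statistics integrate over the
   sublevel ideals of f to relations among the piecewise-linear ones. *)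
Lemma pl_ddeg_span (delta : R) (c : P -> R) (f : P -> R) :
  (forall I, I \in ideals P ->
    (ddeg I)%:R = delta + \sum_p c p * toggle_stat R p I) ->
  in_order_polytope f ->
  pl_ddeg f =
    delta + \sum_p c p * ((f p - max_below f p) - pl_toggle_minus p f).
Proof.
move=> ddegE fO.
have [|ws wsP wsE] :=
    @threshold_quadrature R [seq hat_fun f x | x <- enum {: hat P}].
  by move=> _ /mapP[x _ ->]; exact: hat_fun_bounds.
have quad x : \sum_(w <- ws) w.1 * (w.2 < hat_fun f x)%R%:R = hat_fun f x.
  by apply: wsE; rewrite map_f // mem_enum.
have quad_minus p :
    \sum_(w <- ws) w.1 * toggle_minus R p (sublevel f w.2) =
      pl_toggle_minus p f.
  rewrite /pl_toggle_minus; have [x _ fx] := min_above_attained f p.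
  rewrite fx -[RHS]/(hat_fun f x - hat_fun f (hin p)).
  rewrite -(quad x) -(quad (hin p)) -sumrB.
  rewrite !big_seq; apply: eq_bigr => w /wsP/andP[_ w1].
  by rewrite toggle_minus_sublevel // fx mulrBr.
have quad_plus p :
    \sum_(w <- ws) w.1 * toggle_plus R p (sublevel f w.2) = f p - max_below f p.
  have [x _ fx] := max_below_attained f p.
  rewrite fx -[RHS]/(hat_fun f (hin p) - hat_fun f x).
  rewrite -(quad x) -(quad (hin p)) -sumrB.
  rewrite !big_seq; apply: eq_bigr => w /wsP/andP[w0 _].
  by rewrite toggle_plus_sublevel // fx mulrBr.
have quad_one : \sum_(w <- ws) w.1 = 1.
  (* All nodes lie below 1, the value at [htop], so the rule applied there returns the total
     weight. *)
  rewrite -[RHS]/(hat_fun f htop) -(quad htop) !big_seq.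
  by apply: eq_bigr => w /wsP/andP[_ w1]; rewrite /= w1 mulr1.
rewrite /pl_ddeg; under eq_bigr do rewrite -quad_minus.
rewrite exchange_big /=.
(* At a fixed threshold the removals sum to [ddeg] of the sublevel ideal, where the assumed identity
   applies. *)
under eq_bigr => w _ do rewrite -mulr_sumr -ddeg_sum ?sublevel_ideal // ddegE
  ?sublevel_ideal // mulrDr.
rewrite big_split /= -mulr_suml quad_one mul1r; congr (_ + _).
under eq_bigr do rewrite mulr_sumr.
rewrite exchange_big /=; apply: eq_bigr => p _.
rewrite -quad_plus -quad_minus -sumrB mulr_sumr; apply: eq_bigr => w _.
by rewrite /toggle_stat -mulrBr mulrCA.
Qed.

End PLTransfer.

(** * Telescoping along orbits and convergence *)

Theorem theorem4p32 (R : realType) (d : Order.disp_t) (P : finPOrderType d)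
    (delta : R) (s : seq P) (f : P -> R) :
  tCDE P R -> delta = edge_density P R ->
  linear_extension s -> in_order_polytope f ->
  (fun n : nat => n%:R^-1 * \sum_(i < n) pl_ddeg (iter i (pl_row s) f)) @ \oo
    --> delta.
Proof.
move=> tcde deltaE s_ext fO.
have [c cE] := tCDE_span tcde; rewrite -deltaE in cE.
pose g i := iter i (pl_row s) f.
have gO i : in_order_polytope (g i).
  by elim: i => //= i; exact: pl_row_polytope.
(* By [pl_toggle_minus_row], the correction at time [i] is a difference of [pl_toggle_minus] at
   times [i + 1] and [i]; [err n] is the telescoped total. *)
pose err n :=
  \sum_p c p * (pl_toggle_minus p (g n) - pl_toggle_minus p (g 0%N)).
have sumE n : \sum_(i < n) pl_ddeg (g i) = delta * n%:R + err n.
  elim: n => [|n IHn].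
    by rewrite big_ord0 mulr0 /err big1 ?addr0 // => p _; rewrite subrr mulr0.
  rewrite big_ord_recr /= IHn (pl_ddeg_span _ _ _ cE (gO n)).
  rewrite -natr1 mulrDr mulr1 addrACA; congr (_ + _).
  rewrite /err -big_split /=; apply: eq_bigr => p _.
  by rewrite /= pl_toggle_minus_row // -mulrDr; congr (_ * _); lra.
(* Each [pl_toggle_minus] lies in [0, 1] on the polytope, so each difference in [err] has absolute
   value at most 1. *)
pose K := \sum_p `|c p|.
have errK n : `|err n| <= K.
  apply: le_trans (ler_norm_sum _ _ _) _; apply: ler_sum => p _.
  rewrite normrM ler_piMr // ler_norml /pl_toggle_minus.
  have [? ? ? ?] := toggle_bounds _ (gO n) p.
  have [? ? ? ?] := toggle_bounds _ (gO 0%N) p.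
  by apply/andP; split; lra.
have cvg_err : n%:R^-1 * err n @[n --> \oo] --> (0 : R).
  apply/cvgr0Pnorm_le => e e0; near=> n.
  have n0 : 0 < n%:R :> R by rewrite ltr0n; near: n; exact: nbhs_infty_gt.
  rewrite normrM gtr0_norm ?invr_gt0 // mulrC ler_pdivrMr //.
  apply: le_trans (errK n) _; rewrite -ler_pdivrMl // mulrC.
  by near: n; exact: nbhs_infty_ger.
rewrite -[X in _ --> X]addr0.
apply: (@cvg_trans _ ((fun n => delta + n%:R^-1 * err n) @ \oo)); last first.
  by apply: cvgD => //; exact: cvg_cst.
(* The two sequences are compared only for [n > 0]: since [0^-1 = 0], the average at [n = 0] is 0
   rather than [delta]. *)
apply: near_eq_cvg; near=> n.
have n0 : n%:R != 0 :> R.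
  by rewrite pnatr_eq0 -lt0n; near: n; exact: nbhs_infty_gt.
by rewrite sumE mulrDr mulrCA mulVf // mulr1.
Unshelve. all: by end_near.
Qed.
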